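(* For every integer $n > 2$, $\phi_n(0) = v(n)$.
   Context: For an integer $n \ge 3$, let $\phi_n(x) \in \mathbb{Z}[x]$ denote the minimal polynomial of $4\sin^2\left(\frac{\pi}{n}\right)$, normalized (up to sign) so that its constant term is positive; equivalently, $\phi_n(x) = \prod_{0 < j < \frac{n}{2},\ \gcd(j,n)=1} \left(4\sin^2\left(\frac{j\pi}{n}\right) - x\right)$, a polynomial of degree $\varphi(n)/2$ with leading coefficient $\pm 1$, where $\varphi$ is Euler's totient function. For an integer $n > 1$, define $v(n) = p$ if $n = p^k$ is a power ($k \ge 1$) of a prime $p$, and $v(n) = 1$ otherwise. *)

(* Defs.v *)
From HB Require Import structures.
From mathcomp Require Import all_boot all_order all_algebra.
From mathcomp Require Import boolp classical_sets reals trigo.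

Set Implicit Arguments.
Unset Strict Implicit.
Unset Printing Implicit Defensive.

Import Order.TTheory GRing.Theory Num.Theory.
Local Open Scope ring_scope.
Local Open Scope classical_set_scope.

Definition is_minpoly (R : realType) (a : R) (q : {poly rat}) : Prop :=
  [/\ q \is monic,
      root (map_poly ratr q) a &
      forall r : {poly rat},
        r != 0 -> root (map_poly ratr r) a -> (size q <= size r)%N].

(* Over Z the minimal polynomial of an algebraic integer is only fixed up to
   sign; the sign is chosen here to make the constant term positive. *)
Definition is_pos_minpoly (R : realType) (a : R) (p : {poly int}) : Prop :=
  0 < p`_0 /\
  (is_minpoly a (map_poly intr p) \/ is_minpoly a (map_poly intr (- p))).

(* The default value 0 is only returned if no such polynomial exists; it has
   constant term 0, which is never a value of v. *)
Definition phi (R : realType) (n : nat) : {poly int} :=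
  xget 0 [set p | is_pos_minpoly (4 * sin (pi / n%:R : R) ^+ 2) p].

(* The prime p is unique by unique factorization; the default value 1 is
   returned exactly when n is not a prime power. *)
Definition v (n : nat) : nat :=
  xget 1%N [set p | prime p /\ exists2 k, (1 <= k)%N & n = (p ^ k)%N].

(* Main.v *)
(* Let z = exp(2 i pi / n).  Then 4 sin^2 (pi / n) = 2 - z - z^-1
   = - (1 - z)^2 / z.  For n > 2 the cyclotomic polynomial Phi_n is palindromic
   of even degree 2d, hence Phi_n(X) = X^d P(- (1 - X)^2 / X) for some integer
   polynomial P of degree d.  The irreducibility of Phi_n makes P, up to sign,
   the minimal polynomial of 4 sin^2 (pi / n), and X = 1 gives P(0) = Phi_n(1).
   The value Phi_n(1) = v(n) comes from the factorization of
   (X^n - 1) / (X - 1) into cyclotomic polynomials, evaluated at 1. *)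
Require Import Defs.
From HB Require Import structures.
From mathcomp Require Import all_boot all_order all_algebra.
From mathcomp Require Import boolp classical_sets reals trigo.
From mathcomp Require Import algC cyclotomic.
From mathcomp Require Import complex.
From mathcomp Require Import ring lra.

Set Implicit Arguments.
Unset Strict Implicit.
Unset Printing Implicit Defensive.

Import Order.TTheory GRing.Theory Num.Theory.
Local Open Scope ring_scope.

(** * Values of cyclotomic polynomials at 1 *)

Lemma Cyclotomic1 : 'Phi_1 = 'X - 1.
Proof.
have := prod_Cyclotomic (ltn0Sn 0).
have ->: divisors 1 = [:: 1%N] by [].
by rewrite big_seq1 expr1.
Qed.

Lemma horner_sum_expr1 (A : comNzRingType) n :
  (\sum_(i < n) 'X^i : {poly A}).[1] = n%:R.
Proof.
rewrite horner_sum (eq_bigr (fun=> 1)) => [|i _]; last by rewrite hornerXn expr1n.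
by rewrite sumr_const card_ord.
Qed.

(** The factor for d = 1 is X - 1; cancelling it in the factorization of X^n - 1 leaves 1 + X + ...
    + X^(n-1). *)
Lemma prod_Cyclotomic_at1 n : (0 < n)%N ->
  \prod_(d <- divisors n | d != 1%N) ('Phi_d).[1] = n%:R.
Proof.
move=> n_gt0; rewrite -(horner_sum_expr1 int n) -horner_prod; congr (_.[1]).
have X1_neq0 : 'X - 1 != 0 :> {poly int} by rewrite polyXsubC_eq0.
apply: (mulfI X1_neq0); rewrite -subrX1 -prod_Cyclotomic //.
rewrite [RHS](bigD1_seq 1%N) ?divisors_uniq -?dvdn_divisors //=.
by rewrite Cyclotomic1.
Qed.

(** Strong induction: the product over the divisors d != 1 is n > 0, and all its factors other than
    that of n are positive by induction. *)
Lemma Cyclotomic_at1_gt0 n : (1 < n)%N -> 0 < ('Phi_n).[1].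
Proof.
elim/ltn_ind: n => n IHn n_gt1; have n_gt0 := ltnW n_gt1.
have := prod_Cyclotomic_at1 n_gt0.
rewrite -big_filter (bigD1_seq n) /=; last 2 first.
- by rewrite mem_filter -dvdn_divisors // dvdnn andbT neq_ltn n_gt1 orbT.
- by rewrite filter_uniq ?divisors_uniq.
move=> prod_eq; have : 0 < n%:R :> int by rewrite ltr0n.
rewrite -prod_eq pmulr_lgt0 //.
rewrite big_filter_cond big_seq_cond prodr_gt0 // => d.
rewrite -dvdn_divisors // => /and3P[dvd_dn d_neq1 d_neqn].
have d_gt0 := dvdn_gt0 n_gt0 dvd_dn.
apply: IHn; first by rewrite ltn_neqAle d_neqn dvdn_leq.
by rewrite ltn_neqAle eq_sym d_neq1.
Qed.

Lemma perm_divisors_pfactor p k : prime p ->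
  perm_eq (divisors (p ^ k.+1)) ((p ^ k.+1)%N :: divisors (p ^ k)).
Proof.
move=> p_pr; have p_gt1 := prime_gt1 p_pr.
have pX_gt0 m : (0 < p ^ m)%N by rewrite expn_gt0 prime_gt0.
apply: uniq_perm; rewrite /= ?divisors_uniq ?andbT //.
  by rewrite -dvdn_divisors // dvdn_Pexp2l // ltnn.
move=> d; rewrite inE -!dvdn_divisors //.
apply/idP/orP => [/(dvdn_pfactor _ _ p_pr)[m le_mk ->] | [/eqP-> // |]].
  rewrite dvdn_Pexp2l // eqn_exp2l //.
  by move: le_mk; rewrite leq_eqVlt ltnS => /orP.
by move=> dv; rewrite expnS dvdn_mull.
Qed.

(** Passing from p^k to p^(k+1) adds a single divisor, so the value is the quotient of the two
    products, p^(k+1) / p^k. *)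
Lemma Cyclotomic_pfactor_at1 p k : prime p -> ('Phi_(p ^ k.+1)).[1] = p%:R.
Proof.
move=> p_pr; have pX_gt0 m : (0 < p ^ m)%N by rewrite expn_gt0 prime_gt0.
have pk_neq0 : (p ^ k)%:R != 0 :> int by rewrite pnatr_eq0 -lt0n.
have e_neq1 : (p ^ k.+1 != 1)%N by rewrite -(expn0 p) eqn_exp2l // prime_gt1.
have := prod_Cyclotomic_at1 (pX_gt0 k.+1).
rewrite (perm_big _ (perm_divisors_pfactor k p_pr)) big_cons e_neq1.
rewrite prod_Cyclotomic_at1 // expnS natrM.
exact: mulIf.
Qed.

(** By coprimality the divisors d != 1 of a and those of b are disjoint, and their factors already
    multiply to a * b. Hence the factor of a * b itself divides 1 in the integers, and it is
    positive. *)
Lemma Cyclotomic_coprime_at1 a b :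
  (1 < a)%N -> (1 < b)%N -> coprime a b -> ('Phi_(a * b)).[1] = 1.
Proof.
move=> a_gt1 b_gt1 co_ab; have [a_gt0 b_gt0] := (ltnW a_gt1, ltnW b_gt1).
have n_gt0 : (0 < a * b)%N by rewrite muln_gt0 a_gt0.
set n := (a * b)%N in n_gt0 *.
have n_neq1 : n != 1%N by rewrite muln_eq1 negb_and neq_ltn a_gt1 orbT.
have n_ndvd m c : n = (m * c)%N -> (0 < m)%N -> (1 < c)%N -> (n %| m)%N = false.
  by move=> -> m_gt0 c_gt1; apply/negbTE; rewrite gtnNdvd // ltn_Pmulr.
have n_ndvda := n_ndvd _ _ (erefl : n = (a * b)%N) a_gt0 b_gt1.
have n_ndvdb := n_ndvd _ _ (mulnC a b : n = (b * a)%N) b_gt0 a_gt1.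
pose proper d := d != 1%N.
pose rest := [seq d <- divisors n | [&& d != n, ~~ (d %| a)%N & ~~ (d %| b)%N]].
have perm_s : perm_eq [seq d <- divisors n | proper d]
  (n :: [seq d <- divisors a | proper d] ++ [seq d <- divisors b | proper d]
   ++ rest).
  apply: uniq_perm.
  - by rewrite filter_uniq ?divisors_uniq.
  - rewrite /= !cat_uniq !mem_cat !mem_filter -!dvdn_divisors // n_ndvda n_ndvdb.
    rewrite eqxx !andbF /= !filter_uniq ?divisors_uniq //= andbT.
    apply/andP; split; apply/hasPn => d.
      rewrite mem_cat !mem_filter -!dvdn_divisors // negb_and => /orP[|].
        case/andP=> d_neq1 dvd_b; apply/orP; right; apply/negP => dvd_a.
        move: d_neq1; rewrite /proper -dvdn1 -(eqP co_ab) dvdn_gcd.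
        by rewrite dvd_a dvd_b.
      by case/andP=> /and3P[_ -> _] _; rewrite orbT.
    rewrite !mem_filter -!dvdn_divisors // negb_and => /andP[/and3P[_ _ ->] _].
    by rewrite orbT.
  - move=> d; rewrite inE !mem_cat !mem_filter -!dvdn_divisors // /proper.
    have [->|d_neqn] /= := eqVneq d n; first by rewrite n_neq1 dvdnn.
    have [->|d_neq1] /= := eqVneq d 1%N; first by rewrite !dvd1n.
    have [dvd_a|ndvd_a] /= := boolP (d %| a)%N; first by rewrite dvdn_mulr.
    by have [dvd_b|ndvd_b] /= := boolP (d %| b)%N; first by rewrite dvdn_mull.
have := prod_Cyclotomic_at1 n_gt0.
rewrite -big_filter (perm_big _ perm_s) big_cons !big_cat /= !big_filter.
rewrite !prod_Cyclotomic_at1 //; set r := \prod_(d <- divisors n | _) _.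
(* Regroup as n * (Phi_n(1) * r) = n * 1, so that n cancels. *)
rewrite mulrCA [X in _ * X]mulrCA mulrA -natrM -/n -[RHS]mulr1.
have n_neq0 : n%:R != 0 :> int by rewrite pnatr_eq0 -lt0n.
move/(mulfI n_neq0) => Phi_r.
have n_gt1 : (1 < n)%N by rewrite ltn_neqAle eq_sym n_neq1.
have := Cyclotomic_at1_gt0 n_gt1; move: Phi_r; set x := _.[1] => x_r x_gt0.
move: x_r => /(congr1 absz)/eqP; rewrite abszM muln_eq1 => /andP[/eqP x1 _].
by rewrite -(gtz0_abs x_gt0) x1.
Qed.

Lemma Cyclotomic_at1 n : (1 < n)%N -> ('Phi_n).[1] = (v n)%:R.
Proof.
move=> n_gt1; rewrite /v; case: xgetP => [p _ [p_pr [[//|k] _ ->]] | not_pp].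
  exact: Cyclotomic_pfactor_at1.
have n_gt0 := ltnW n_gt1; set p := pdiv n.
have p_pr : prime p := pdiv_prime n_gt1.
(* Split n into its p-part and the coprime rest; a rest equal to 1 would make n a power of p. *)
rewrite -(partnC p n_gt0); apply: Cyclotomic_coprime_at1.
- by rewrite p_part_gt1 mem_primes p_pr n_gt0 pdiv_dvd.
- rewrite ltn_neqAle part_gt0 andbT; apply/negP => /eqP p'n1.
  apply: (not_pp p); split=> //; exists (logn p n).
    by rewrite logn_gt0 mem_primes p_pr n_gt0 pdiv_dvd.
  by rewrite -p_part -[LHS](partnC p n_gt0) -p'n1 muln1.
- exact: coprime_partC.
Qed.

(** * Palindromes as polynomials in 2 - x - x^-1 *)

(* Substituting 2 - x - x^-1 = - (1 - x)^2 / x in p and clearing the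
   denominator x^d. *)
Definition recip_lift (A : comNzRingType) d (p : {poly A}) : {poly A} :=
  \sum_(k < d.+1) (p`_k * (-1) ^+ k) *: ((1 - 'X) ^+ k.*2 * 'X^(d - k)).

Lemma recip_lift_map (A B : comNzRingType) (f : {rmorphism A -> B}) d p :
  map_poly f (recip_lift d p) = recip_lift d (map_poly f p).
Proof.
rewrite rmorph_sum; apply: eq_bigr => k _.
rewrite /= map_polyZ coef_map !rmorphM rmorphXn rmorphN1 /=.
by rewrite !rmorphXn rmorphB rmorph1 /= map_polyX.
Qed.

(** Here w plays the role of - (1 - z)^2 / z. Stating this without division keeps the lemma valid in
    any commutative ring. *)
Lemma horner_recip_lift (A : comNzRingType) d (p : {poly A}) (z w : A) :
  (size p <= d.+1)%N -> (1 - z) ^+ 2 = - (z * w) ->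
  (recip_lift d p).[z] = z ^+ d * p.[w].
Proof.
move=> sz_p zw; rewrite (horner_coef_wide w sz_p) horner_sum mulr_sumr.
apply: eq_bigr => k _; rewrite hornerZ hornerM !horner_exp !hornerE.
rewrite -mul2n exprM zw (exprNn (z * w)) exprMn.
have -> : z ^+ d = z ^+ k * z ^+ (d - k) by rewrite -exprD subnKC // -ltnS.
(* The left side carries the sign (-1)^k twice, from the definition and from (- (z * w))^k; writing
   1 as its square lets [ring] treat the sign as opaque. *)
rewrite /= -[RHS]mul1r -[X in _ = X * _](sqrr_sign A k).
by move: ((-1) ^+ k) (z ^+ k) (z ^+ (d - k)) (w ^+ k) => s zk zdk wk; ring.
Qed.

Lemma recip_lift_at1 (A : comNzRingType) d (p : {poly A}) :
  (size p <= d.+1)%N -> (recip_lift d p).[1] = p`_0.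
Proof.
(* At z = 1 the relation holds with w = 0. *)
move=> sz_p; rewrite (@horner_recip_lift _ _ _ _ 0) ?subrr ?mulr0 ?oppr0 ?expr0n //.
by rewrite expr1n mul1r horner_coef0.
Qed.

Lemma size_one_sub_X_exp (A : comNzRingType) m :
  (size ((1 - 'X : {poly A}) ^+ m) <= m.+1)%N.
Proof.
by rewrite -opprB exprNn -signr_odd; case: odd; rewrite ?mulN1r ?mul1r ?size_polyN
  size_exp_XsubC.
Qed.

Lemma size_recip_lift (A : comNzRingType) d (p : {poly A}) :
  (size (recip_lift d p) <= d.*2.+1)%N.
Proof.
apply: (leq_trans (size_sum _ _ _)); apply/bigmax_leqP => k _.
apply: (leq_trans (size_scale_leq _ _)); apply: (leq_trans (size_polyMleq _ _)).
rewrite size_polyXn addnS /=; have le_kd : (k <= d)%N by rewrite -ltnS.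
apply: (leq_trans (leq_add (size_one_sub_X_exp _ _) (leqnn _))).
by rewrite addSn ltnS -!addnn -addnA subnKC // leq_add2r.
Qed.

Lemma coef_one_sub_X_exp (A : comNzRingType) m i :
  ((1 - 'X : {poly A}) ^+ m)`_i = (-1) ^+ i * 'C(m, i)%:R.
Proof.
rewrite exprBn coef_sum.
rewrite (eq_bigr (fun j : 'I_m.+1 => (i == j)%:R * ((-1) ^+ j * 'C(m, j)%:R))).
  have [le_im|lt_mi] := leqP i m.
    rewrite (bigD1 (inord i)) //= inordK // eqxx mul1r big1 ?addr0 // => j.
    by rewrite -val_eqE /= inordK // eq_sym => /negPf->; rewrite mul0r.
  rewrite bin_small // mulr0 big1 // => j _.
  by rewrite gtn_eqF ?mul0r // (leq_trans (ltn_ord j)).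
move=> j _; rewrite expr1n mulr1 -mulr_natr -polyC1 -polyCN -polyC_exp.
by rewrite -polyC_natr mulrAC -polyCM coefCM coefXn mulrC.
Qed.

(** The term of index k has degree at most d + k, so only k = d reaches 2d. This controls leading
    coefficients and shows that lifts of nonzero polynomials do not vanish. *)
Lemma coef_recip_lift_max (A : comNzRingType) d (p : {poly A}) :
  (recip_lift d p)`_d.*2 = (-1) ^+ d * p`_d.
Proof.
rewrite /recip_lift big_ord_recr /= coefD subnn expr0 mulr1 coefZ.
rewrite coef_one_sub_X_exp binn mulr1 -(signr_odd _ d.*2) odd_double mulr1.
rewrite mulrC coef_sum big1 ?add0r // => k _; rewrite coefZ coefMXn.
have le_kd : (k <= d)%N by apply: ltnW.
have -> : (d.*2 - (d - k) = d + k)%N by rewrite subnBA // -addnn -addnA addKn.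
by case: ifP => _; rewrite ?coef_one_sub_X_exp ?bin_small ?mulr0 // -addnn ltn_add2r.
Qed.

(** The number m is a formal degree: the top coefficient may vanish, as happens in the induction
    below. *)
Definition palindrome (A : comNzRingType) m (f : {poly A}) :=
  (size f <= m.+1)%N /\ forall i, (i <= m)%N -> f`_i = f`_(m - i).

(** Induction on d: subtracting a multiple of (1 - X)^(2d+2), itself a palindrome, kills the top
    coefficient and by symmetry the constant one. What remains is X times a palindrome of formal
    degree 2d. *)
Lemma palindrome_recip_lift (A : comNzRingType) d (f : {poly A}) :
  palindrome d.*2 f ->
  exists2 p : {poly A}, (size p <= d.+1)%N & f = recip_lift d p.
Proof.
elim: d f => [|d IHd] f [sz_f pal_f].
  exists f => //; rewrite /recip_lift big_ord1 !expr0 !mulr1 alg_polyC.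
  exact: size1_polyC.
(* The sign compensates the factor (-1)^k in [recip_lift] at k = d + 1. *)
pose c := (-1) ^+ d.+1 * f`_(d.+1).*2.
pose g := f - f`_(d.+1).*2 *: (1 - 'X) ^+ (d.+1).*2.
have coef_g i : g`_i = f`_i - f`_(d.+1).*2 * ((-1) ^+ i * 'C((d.+1).*2, i)%:R).
  by rewrite coefB coefZ coef_one_sub_X_exp.
have pal_g i : (i <= (d.+1).*2)%N -> g`_i = g`_((d.+1).*2 - i).
  move=> le_i; rewrite !coef_g pal_f // bin_sub //.
  by rewrite -(signr_odd _ (_ - i)) oddB // odd_double signr_odd.
have g0 : g`_0 = 0.
  by rewrite pal_g // subn0 coef_g binn mulr1 -signr_odd odd_double mulr1 subrr.
have g_max i : (d.*2.+1 < i)%N -> g`_i = 0.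
  rewrite leq_eqVlt => /orP[/eqP<-|lt_i]; first by rewrite pal_g // subnn.
  rewrite coef_g nth_default ?(leq_trans sz_f) //.
  by rewrite bin_small // !mulr0 subr0.
pose h := drop_poly 1 g.
have g_eq : g = h * 'X.
  apply/polyP => -[|i]; rewrite coefMX ?g0 // coef_drop_poly addn1 //.
have [|q sz_q h_eq] := IHd h.
  split=> [|i le_i].
    apply/leq_sizeP => i le_i; rewrite coef_drop_poly addn1.
    by rewrite g_max.
  rewrite !coef_drop_poly !addn1 pal_g; last by rewrite doubleS !ltnS leqW.
  by rewrite doubleS subSS subSn.
exists (q + c *: 'X^(d.+1)).
  apply: (leq_trans (size_polyD _ _)); rewrite geq_max (leq_trans sz_q) //=.
  by rewrite (leq_trans (size_scale_leq _ _)) ?size_polyXn.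
have -> : f = g + f`_(d.+1).*2 *: (1 - 'X) ^+ (d.+1).*2 by rewrite subrK.
rewrite /recip_lift big_ord_recr /= subnn expr0 mulr1 coefD coefZ coefXn eqxx.
rewrite (nth_default _ sz_q) add0r mulr1 mulrC mulrA -expr2 sqrr_sign mul1r.
(* Replacing d by d + 1 multiplies each term of index k <= d by X, which absorbs the factor X of
   g. *)
congr (_ + _); rewrite g_eq h_eq mulr_suml; apply: eq_bigr => k _.
rewrite coefD coefZ coefXn ltn_eqF // mulr0 addr0 -scalerAl -mulrA -exprSr.
by rewrite subSn // -ltnS.
Qed.

(** * Irreducibility and symmetry of cyclotomic polynomials *)

(** Since z is a root of X^n - 1, it is a root of Phi_d for some d dividing n; then z^d = 1, and
    primitivity forces d = n. *)
Lemma root_Cyclotomic (F : idomainType) n (z : F) :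
  n.-primitive_root z -> root (map_poly intr 'Phi_n) z.
Proof.
move=> prim_z; have n_gt0 := prim_order_gt0 prim_z.
have : root (map_poly intr ('X^n - 1)) z.
  by rewrite rmorphB rmorph1 /= map_polyXn rootE !hornerE prim_expr_order ?subrr.
rewrite -prod_Cyclotomic // rmorph_prod rootE horner_prod.
rewrite prodf_seq_eq0 => /hasP[d]; rewrite -dvdn_divisors //= => dvd_dn Phi_d0.
suff -> : n = d by [].
apply/eqP; rewrite eqn_dvd dvd_dn andbT (prim_order_dvd prim_z).
have d_gt0 := dvdn_gt0 n_gt0 dvd_dn.
suff : root (map_poly intr ('X^d - 1)) z.
  by rewrite rmorphB rmorph1 /= map_polyXn rootE !hornerE subr_eq0.
rewrite -prod_Cyclotomic // rmorph_prod rootE horner_prod.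
rewrite prodf_seq_eq0; apply/hasP; exists d => //=.
by rewrite -dvdn_divisors.
Qed.

Lemma map_intr_ratr (F : numFieldType) (p : {poly int}) :
  map_poly ratr (map_poly intr p : {poly rat}) = map_poly intr p :> {poly F}.
Proof.
by rewrite -map_poly_comp; apply: eq_map_poly => a; rewrite /= ratr_int.
Qed.

(** The irreducibility of Phi_n enters here, through [minCpoly_cyclotomic]. *)
Lemma Cyclotomic_dvd_rat n (z : algC) (h : {poly rat}) :
  n.-primitive_root z -> root (map_poly ratr h) z ->
  cyclotomic z n %| map_poly ratr h.
Proof.
move=> prim_z; rewrite -(minCpoly_cyclotomic prim_z).
by have [q [-> _] ->] := minCpolyP z; rewrite dvdp_map.
Qed.

(** Irreducibility is known over [algC], while z lies in F. A common root in F makes Phi_n and h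
    non-coprime over the rationals, hence gives them a common root in [algC], which is a primitive
    n-th root of unity there. *)
Lemma totient_lt_size_root (F : numFieldType) n (z : F) (h : {poly rat}) :
  n.-primitive_root z -> h != 0 -> root (map_poly ratr h) z ->
  (totient n < size h)%N.
Proof.
move=> prim_z h_neq0 hz0.
have [y prim_y] := C_prim_root_exists (prim_order_gt0 prim_z).
pose Phi : {poly rat} := map_poly intr 'Phi_n.
have PhiC : map_poly ratr Phi = cyclotomic y n.
  by rewrite map_intr_ratr (Cintr_Cyclotomic prim_y).
have ncop : ~~ coprimep Phi h.
  rewrite -(coprimep_map (ratr : {rmorphism rat -> F})).
  apply/negP => /coprimep_root cop.
  have := cop z; rewrite map_intr_ratr root_Cyclotomic // => /(_ isT).
  by rewrite -rootE hz0.
have [x x_root hx0] : exists2 x : algC, root (cyclotomic y n) x &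
    root (map_poly ratr h) x.
  apply: contrapT => no_x; case/negP: ncop.
  rewrite -(coprimep_map (ratr : {rmorphism rat -> algC})) PhiC.
  apply: Pdiv.ClosedField.root_coprimep => x x_root.
  by apply/negP => hx0; apply: no_x; exists x.
have prim_x : n.-primitive_root x by rewrite -(root_cyclotomic prim_y).
have hC_neq0 : map_poly (ratr : rat -> algC) h != 0 by rewrite map_poly_eq0.
have := dvdp_leq hC_neq0 (Cyclotomic_dvd_rat prim_x hx0).
by rewrite size_cyclotomic size_map_poly.
Qed.

Lemma horner_reverse (F : fieldType) m (f : {poly F}) z :
  (size f <= m.+1)%N -> z != 0 ->
  (\poly_(i < m.+1) f`_(m - i)).[z] = z ^+ m * f.[z^-1].
Proof.
move=> sz_f z_neq0; rewrite horner_poly (horner_coef_wide _ sz_f) mulr_sumr.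
rewrite (reindex_inj rev_ord_inj) /=; apply: eq_bigr => i _.
have le_im : (i <= m)%N by rewrite -ltnS.
by rewrite subSS subKn // exprVn mulrCA -expfB_cond ?(negPf z_neq0).
Qed.

Lemma map_reverse_poly (A B : nzRingType) (f : {rmorphism A -> B}) m (p : {poly A}) :
  map_poly f (\poly_(i < m.+1) p`_(m - i)) =
  \poly_(i < m.+1) (map_poly f p)`_(m - i).
Proof.
apply/polyP => i; rewrite coef_map coef_poly [RHS]coef_poly.
case: ifP => _; last by apply: rmorph0.
by rewrite coef_map; reflexivity.
Qed.

(** The inverse of a primitive root is again primitive, so the reversed polynomial g vanishes at z
    and must be proportional to Phi_n. *)
Lemma Cyclotomic_palindrome n : (2 < n)%N ->
  ~~ odd (totient n) /\ palindrome (totient n) 'Phi_n.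
Proof.
move=> n_gt2; have n_gt0 : (0 < n)%N by apply: leq_trans n_gt2.
have [z prim_z] := C_prim_root_exists n_gt0.
set m := totient n; pose f : {poly rat} := map_poly intr 'Phi_n.
have z_neq0 : z != 0 by rewrite (prim_root_eq0 prim_z) -lt0n.
have mapf : map_poly ratr f = cyclotomic z n.
  by rewrite map_intr_ratr (Cintr_Cyclotomic prim_z).
have sz_f : (size f <= m.+1)%N.
  by rewrite (leq_trans (size_poly _ _)) ?size_Cyclotomic.
pose g : {poly rat} := \poly_(i < m.+1) f`_(m - i).
have coef_g i : g`_i = if (i < m.+1)%N then f`_(m - i) else 0 by exact: coef_poly.
have f_m : f`_m = 1.
  have := Cyclotomic_monic n; rewrite monicE lead_coefE size_Cyclotomic /=.
  by rewrite coef_map => /eqP->.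
have gz0 : root (map_poly ratr g) z.
  rewrite map_reverse_poly mapf rootE horner_reverse ?size_cyclotomic //.
  rewrite mulf_eq0 -rootE (root_cyclotomic prim_z).
  have -> : z^-1 = z ^+ n.-1.
    apply: (mulfI z_neq0); rewrite -exprS prednK // mulfV //.
    by rewrite (prim_expr_order prim_z).
  by rewrite prim_root_exp_coprime // coprimePn // orbT.
(* The scalar matches the coefficients of X^m; the difference then has degree below m and vanishes
   at z, so it is 0. *)
have g_eq : g = f`_0 *: f.
  apply/eqP; rewrite -subr_eq0; apply: contraT => k_neq0.
  have /(totient_lt_size_root prim_z k_neq0) : root (map_poly ratr (g - f`_0 *: f)) z.
    rewrite rmorphB /= map_polyZ mapf rootE hornerD hornerN hornerZ (rootP gz0).
    have /rootP-> : root (cyclotomic z n) z by rewrite (root_cyclotomic prim_z).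
    by rewrite mulr0 subr0.
  rewrite ltnNge => /negP[]; apply/leq_sizeP => i; rewrite coefB coefZ coef_g.
  rewrite leq_eqVlt => /orP[/eqP<-|lt_mi].
    by rewrite ltnSn subnn f_m mulr1 subrr.
  have -> : f`_i = 0 by apply: nth_default; apply: leq_trans lt_mi.
  by rewrite ltnS leqNgt lt_mi mulr0 subrr.
(* Reversal preserves the value at 1, and Phi_n(1) is nonzero. *)
have f_0 : f`_0 = 1.
  have f1_neq0 : f.[1] != 0.
    rewrite -(rmorph1 (intr : {rmorphism int -> rat})) horner_map intr_eq0 gt_eqF //.
    by rewrite Cyclotomic_at1_gt0 // ltnW.
  have := horner_reverse sz_f (oner_neq0 _).
  rewrite -/g g_eq hornerZ invr1 expr1n => /(mulIf f1_neq0).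
  by [].
have gf : g = f by rewrite g_eq f_0 scale1r.
split.
  (* For odd m, reversal at -1 gives f(-1) = - f(-1). Then -1 would be a primitive n-th root, so n
     would divide 2. *)
  apply/negP => m_odd.
  have N1_neq0 : -1 != 0 :> rat by rewrite oppr_eq0 oner_eq0.
  have := horner_reverse sz_f N1_neq0.
  rewrite -/g gf invrN1 -signr_odd m_odd mulN1r => /eqP.
  rewrite -subr_eq0 opprK -mulr2n mulrn_eq0 /= => fN1.
  have : root (map_poly (ratr : rat -> algC) f) (ratr (-1)).
    by rewrite fmorph_root rootE.
  rewrite mapf (root_cyclotomic prim_z) rmorphN1 => prim_N1.
  have := dvdn_leq (isT : (0 < 2)%N).
  move/(_ n); rewrite (prim_order_dvd prim_N1) sqrrN expr1n eqxx => /(_ isT).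
  by rewrite leqNgt n_gt2.
split=> [|i le_im]; first by rewrite size_Cyclotomic.
apply: (intr_inj (R := rat)); rewrite -!coef_map -/f -{1}gf coef_g ltnS le_im.
by [].
Qed.

(** * The root of unity exp(2 i pi / n) over a real field *)

Lemma expr_cos_sin (R : realType) (t : R) k :
  (Complex (cos t) (sin t)) ^+ k = Complex (cos (t *+ k)) (sin (t *+ k)).
Proof.
elim: k => [|k IHk]; first by rewrite expr0 !mulr0n cos0 sin0.
rewrite exprS IHk !mulrS cosD sinD; apply/eqP; rewrite eq_complex /=.
by rewrite eqxx /= addrC.
Qed.

Lemma cos_sin_prim_root (R : realType) n (t : R := pi / n%:R *+ 2) :
  (0 < n)%N -> n.-primitive_root (Complex (cos t) (sin t)).
Proof.
move=> n_gt0; have n_gt0R : 0 < n%:R :> R by rewrite ltr0n.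
have unity : (Complex (cos t) (sin t)) ^+ n = 1.
  rewrite expr_cos_sin /t -mulrnA mulnC mulrnA -(mulr_natr (pi / _) n).
  by rewrite divfK ?gt_eqF // cos2pi sin2pi.
have [m prim_m dvd_mn] := prim_order_exists n_gt0 unity.
suff m_eq_n : m = n by move: prim_m; rewrite m_eq_n.
apply/eqP; rewrite eqn_leq dvdn_leq //= leqNgt; apply/negP => lt_mn.
have m_gt0 := prim_order_gt0 prim_m.
have := prim_expr_order prim_m.
(* If the order m were below n, the real part of z^m = 1 would give 1 - 2 sin^2 (m pi / n) = 1,
   although 0 < m pi / n < pi. *)
rewrite expr_cos_sin => -[+ _]; rewrite /t -mulrnA mulnC mulrnA cos_mulr2n cos2sin2.
have : 0 < sin (pi / n%:R *+ m : R).
  apply: sin_gt0_pi; rewrite -(mulr_natr (pi / _)) mulrAC.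
  rewrite divr_gt0 ?mulr_gt0 ?pi_gt0 ?ltr0n //=.
  by rewrite ltr_pdivrMr // ltr_pM2l ?pi_gt0 // ltr_nat.
move: (sin _) => s s_gt0 s_eq.
have : s ^+ 2 = 0 by move: s_eq; rewrite mulr2n; lra.
by apply/eqP; rewrite sqrf_eq0 gt_eqF.
Qed.

(** This is the relation required by [horner_recip_lift], with w = 4 sin^2 t. *)
Lemma sqr_one_sub_cos_sin (R : realType) (t : R) :
  let z := Complex (cos (t *+ 2)) (sin (t *+ 2)) in
  (1 - z) ^+ 2 = - (z * real_complex R (4 * sin t ^+ 2)).
Proof.
move=> z; rewrite /z cos_mulr2n sin_mulr2n.
have := cos2Dsin2 t; move: (cos t) (sin t) => c s cs.
apply/eqP; rewrite expr2 eq_complex /=.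
have s2 : s ^+ 2 = 1 - c ^+ 2 by rewrite -cs addrAC subrr add0r.
by apply/andP; split; apply/eqP; ring: s2.
Qed.

(** * The minimal polynomial of 4 sin^2 (pi / n) *)

Lemma map_ratr_complex (R : realType) (p : {poly rat}) (x : R) :
  (map_poly ratr p).[real_complex R x] = real_complex R (map_poly ratr p).[x].
Proof.
rewrite -horner_map -map_poly_comp; congr (_.[_]).
by apply: eq_map_poly => a /=; rewrite fmorph_rat.
Qed.

Lemma root_recip_lift_cos_sin (R : realType) n d (p : {poly rat}) : (0 < n)%N ->
  (size p <= d.+1)%N -> let t : R := pi / n%:R in
  root (map_poly ratr (recip_lift d p)) (Complex (cos (t *+ 2)) (sin (t *+ 2)))
  = root (map_poly ratr p) (4 * sin t ^+ 2).
Proof.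
move=> n_gt0 sz_p t; set z := Complex _ _.
have z_neq0 : z != 0.
  by rewrite (prim_root_eq0 (cos_sin_prim_root R n_gt0)) -lt0n.
rewrite recip_lift_map rootE (horner_recip_lift _ (sqr_one_sub_cos_sin t)).
  rewrite mulf_eq0 expf_eq0 (negPf z_neq0) andbF /= map_ratr_complex.
  by rewrite fmorph_eq0.
by rewrite (leq_trans (size_poly _ _)).
Qed.

(** The lift of r vanishes at a primitive n-th root of unity and has degree at most 2 deg r; it is
    nonzero because its coefficient of that degree is, up to sign, the leading one of r. *)
Lemma totient_le_size_minpoly (R : realType) n (r : {poly rat}) : (0 < n)%N ->
  r != 0 -> root (map_poly ratr r) (4 * sin (pi / n%:R : R) ^+ 2) ->
  (totient n <= (size r).-1.*2)%N.
Proof.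
move=> n_gt0 r_neq0; have sz_r : (size r <= (size r).-1.+1)%N by apply: leqSpred.
rewrite -(root_recip_lift_cos_sin _ n_gt0 sz_r) => lift0.
rewrite -ltnS; apply: leq_trans (size_recip_lift _ _).
apply: totient_lt_size_root (cos_sin_prim_root R n_gt0) _ lift0.
apply: contraNneq r_neq0 => lift_eq0.
have := coef_recip_lift_max (size r).-1 r.
rewrite lift_eq0 coef0 => /esym/eqP.
by rewrite mulf_eq0 signr_eq0 -lead_coefE lead_coef_eq0.
Qed.

Lemma is_minpoly_unique (R : realType) (a : R) (p q : {poly rat}) :
  is_minpoly a p -> is_minpoly a q -> p = q.
Proof.
move=> [mon_p pa0 min_p] [mon_q qa0 min_q]; apply/eqP; rewrite -subr_eq0.
apply: contraT => pq_neq0.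
have sz_pq : size p = size q.
  by apply/eqP; rewrite eqn_leq min_p ?monic_neq0 ?min_q ?monic_neq0.
have : (size p <= size (p - q)%R)%N.
  apply: min_p => //; rewrite rmorphB /= rootE hornerD hornerN.
  by rewrite (rootP pa0) (rootP qa0) subrr.
rewrite leqNgt => /negP[].
have p_gt0 : (0 < size p)%N by rewrite size_poly_gt0 monic_neq0.
rewrite -(prednK p_gt0) ltnS; apply/leq_sizeP => i; rewrite coefB.
rewrite leq_eqVlt => /orP[/eqP<-|].
  rewrite -lead_coefE (monicP mon_p) sz_pq -lead_coefE (monicP mon_q).
  exact: subrr.
rewrite prednK // => le_i.
by rewrite !nth_default ?subrr // -sz_pq.
Qed.

(** When the two signs differ, uniqueness makes the polynomials opposite, contradicting the
    positivity of both constant terms. *)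
Lemma is_pos_minpoly_coef0 (R : realType) (a : R) (p q : {poly int}) :
  is_pos_minpoly a p -> is_pos_minpoly a q -> p`_0 = q`_0.
Proof.
have inj_map := @map_inj_poly _ _ (intr : int -> rat) intr_inj (rmorph0 _).
have gt0N (f g : {poly int}) : f = - g -> 0 < f`_0 -> 0 < g`_0 -> f`_0 = g`_0.
  by move=> ->; rewrite coefN oppr_gt0 => /lt_trans lt0 /lt0; rewrite ltxx.
move=> [p0 [|] min_p] [q0 [|] min_q];
  have /inj_map eq_pq := is_minpoly_unique min_p min_q.
- by rewrite eq_pq.
- exact: gt0N.
- by symmetry; apply: gt0N.
- by rewrite (oppr_inj eq_pq).
Qed.

Lemma Cyclotomic_recip_lift_minpoly (R : realType) n d (p : {poly int}) :
  (1 < n)%N -> totient n = d.*2 -> (size p <= d.+1)%N ->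
  'Phi_n = recip_lift d p ->
  is_pos_minpoly (4 * sin (pi / n%:R : R) ^+ 2) p.
Proof.
move=> n_gt1 tot_n sz_p Phi_eq; have n_gt0 := ltnW n_gt1.
split; first by rewrite -(recip_lift_at1 sz_p) -Phi_eq Cyclotomic_at1_gt0.
have lead_p : (-1) ^+ d * p`_d = 1.
  rewrite -coef_recip_lift_max -Phi_eq -tot_n.
  by have := Cyclotomic_monic n; rewrite monicE lead_coefE size_Cyclotomic => /eqP.
(* The leading coefficient of p is (-1)^d, so the monic one among p and -p is obtained with the sign
   given by the parity of d. *)
have minpoly_sign (b : bool) : b = odd d ->
    is_minpoly (4 * sin (pi / n%:R : R) ^+ 2) (map_poly intr ((-1) ^+ b *: p)).
  move=> b_eq; have coef_d : ((-1) ^+ b *: p)`_d = 1.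
    by rewrite coefZ b_eq signr_odd.
  have sz_bp : (size ((-1) ^+ b *: p) <= d.+1)%N by rewrite (leq_trans (size_scale_leq _ _)).
  have sz_eq : size ((-1) ^+ b *: p) = d.+1.
    apply/eqP; rewrite eqn_leq sz_bp ltnNge; apply/negP => /leq_sizeP/(_ d (leqnn d)).
    by rewrite coef_d => /eqP; rewrite oner_eq0.
  split.
  - by apply: monic_map; rewrite monicE lead_coefE sz_eq coef_d.
  - rewrite map_polyZ /= rmorph_sign map_polyZ rmorph_sign rootZ ?signr_eq0 //.
    rewrite -(root_recip_lift_cos_sin _ n_gt0 (leq_trans (size_poly _ _) sz_p)).
    rewrite -recip_lift_map -Phi_eq map_intr_ratr.
    exact: root_Cyclotomic (cos_sin_prim_root R n_gt0).
  - move=> r r_neq0 /(totient_le_size_minpoly n_gt0 r_neq0).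
    rewrite tot_n leq_double => le_d.
    rewrite (leq_trans (size_poly _ _)) // sz_eq.
    by apply: leq_ltn_trans le_d _; rewrite prednK // size_poly_gt0.
have := minpoly_sign _ erefl; case: odd; first by rewrite scaleN1r; right.
by rewrite scale1r; left.
Qed.

Theorem theorem1 (R : realType) (n : nat) (hn : (2 < n)%N) :
  (phi R n).[0] = (v n)%:Z.
Proof.
have n_gt1 := ltnW hn; have [even_tot] := Cyclotomic_palindrome hn.
have tot_n : totient n = (totient n)./2.*2 by rewrite even_halfK.
rewrite {1}tot_n => /palindrome_recip_lift[p sz_p Phi_eq].
have min_p := Cyclotomic_recip_lift_minpoly R n_gt1 tot_n sz_p Phi_eq.
have p0 : p`_0 = (v n)%:Z.
  by rewrite -(recip_lift_at1 sz_p) -Phi_eq Cyclotomic_at1 // natz.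
(* [xget] returns some q with the defining property, which shares its constant term with p; the
   existence of p excludes the default value. *)
rewrite horner_coef0 -p0 /phi; case: xgetP => [q _ min_q | no_p].
  exact: is_pos_minpoly_coef0 min_q min_p.
by have := no_p _ min_p.
Qed.
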